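(* Let $x_1,\ldots,x_k$ and $y_1,\ldots,y_k$ be vectors in a Hilbert space $H$ such that the operator $R=I-\sum_{j=1}^k\theta_{y_j,x_j}\in\mathbb B(H)$ is invertible. Then $$R^{-1}=I+\sum_{i,j=1}^kc_{ij}\theta_{y_i,x_j},$$ where the coefficient matrix $C=(c_{ij})$ is given by $$C=-\begin{bmatrix}\langle y_1,x_1\rangle-1&\langle y_2,x_1\rangle&\ldots&\langle y_k,x_1\rangle\\ \langle y_1,x_2\rangle&\langle y_2,x_2\rangle-1&\ldots&\langle y_k,x_2\rangle\\ \vdots&\vdots&&\vdots\\ \langle y_1,x_k\rangle&\langle y_2,x_k\rangle&\ldots&\langle y_k,x_k\rangle-1\end{bmatrix}^{-1}$$ (in particular, the matrix on the right-hand side is invertible).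
   Context: $H$ is a complex Hilbert space with inner product linear in the first argument, and $\mathbb B(H)$ is the set of bounded operators on $H$. For $x,y\in H$, $\theta_{y,x}$ is the operator on $H$ given by $\theta_{y,x}(v)=\langle v,x\rangle y$, $v\in H$. *)

(* Defs.v *)
From HB Require Import structures.
From mathcomp Require Import all_boot all_order all_algebra.
From mathcomp Require Import sesquilinear complex.
From mathcomp Require Import all_classical all_reals topology normedtype.
Import numFieldNormedType.Exports.
Import Order.TTheory GRing.Theory Num.Theory.

Set Implicit Arguments.
Unset Strict Implicit.
Unset Printing Implicit Defensive.

Local Open Scope ring_scope.
Local Open Scope complex_scope.

(* A complex Hilbert space is a Banach space over R[i] whose norm comes from an
   inner product.  [{dot H for Num.conj}] is the type of positive definite
   hermitian forms; these are linear in the FIRST argument and conjugate-linear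
   in the second. *)
HB.mixin Record isHilbert (R : realType) H of CompleteNormedModule R[i] H := {
  inner : {dot H for (@Num.conj R[i])};
  inner_norm : forall v : H, inner v v = `|v| ^+ 2
}.

#[short(type="hilbertType")]
HB.structure Definition Hilbert (R : realType) :=
  {H of isHilbert R H & CompleteNormedModule R[i] H}.

Section BoundedOperators.
Variables (R : realType) (H : hilbertType R).

Definition bounded_linear : {pred H -> H} := fun f =>
  `[< linear f /\ exists M : R[i], forall v, `|f v| <= M * `|v| >].

Lemma bounded_linearP (f : H -> H) :
  reflect (linear f /\ exists M : R[i], forall v, `|f v| <= M * `|v|)
          (f \in bounded_linear).
Proof. exact: asboolP. Qed.

Lemma bound_ge0 (f : H -> H) : f \in bounded_linear ->
  exists2 M : R[i], 0 <= M & forall v, `|f v| <= M * `|v|.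
Proof.
move=> /bounded_linearP[lf [M fM]].
have [[v v0]|H0] := pselect (exists v : H, v != 0).
  exists M => //; have v1 : 0 < `|v| by rewrite normr_gt0.
  by rewrite -(pmulr_lge0 _ v1); exact: le_trans (fM v).
exists 0 => // v; have -> : v = 0.
  by apply/eqP/negPn/negP => v0; apply: H0; exists v.
by have := fM 0; rewrite !normr0 !mulr0.
Qed.

Lemma bounded_linear_submod : submod_closed bounded_linear.
Proof.
split.
  apply/bounded_linearP; split=> [a u v|]; first by rewrite scaler0 addr0.
  by exists 0 => v; rewrite normr0 mul0r.
move=> a f g fB gB.
have [[lf _] [lg _]] := (bounded_linearP _ fB, bounded_linearP _ gB).
have [[M M0 fM] [N N0 gN]] := (bound_ge0 fB, bound_ge0 gB).
apply/bounded_linearP; split=> [b u v|].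
  rewrite /= !fctE lf lg !scalerDr !scalerA (mulrC a b).
  by rewrite -!addrA; congr (_ + _); rewrite addrCA.
exists (`|a| * M + N) => v; rewrite /= !fctE mulrDl.
apply: le_trans (ler_normD _ _) _; apply: lerD => //.
by rewrite normrZ -mulrA ler_wpM2l.
Qed.

HB.instance Definition _ :=
  GRing.isSubmodClosed.Build R[i] (H -> H) bounded_linear bounded_linear_submod.

Record bounded_op := BoundedOp {
  bounded_op_fun :> H -> H;
  bounded_op_prop : bounded_op_fun \in bounded_linear
}.

HB.instance Definition _ := [isSub for bounded_op_fun].
HB.instance Definition _ := [Choice of bounded_op by <:].
HB.instance Definition _ := [SubChoice_isSubLmodule of bounded_op by <:].

Lemma bounded_op_ext (S T : bounded_op) : S =1 T -> S = T.
Proof. by move=> ST; apply/val_inj/funext. Qed.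

Lemma bounded_op_linear (T : bounded_op) : linear T.
Proof. by have /bounded_linearP[] := bounded_op_prop T. Qed.

Lemma bounded_opDE (S T : bounded_op) v : (S + T) v = S v + T v.
Proof. by []. Qed.

Lemma bounded_opZE (a : R[i]) (T : bounded_op) v : (a *: T) v = a *: T v.
Proof. by []. Qed.

Lemma bounded_linear_id : (id : H -> H) \in bounded_linear.
Proof. by apply/bounded_linearP; split=> //; exists 1 => v; rewrite mul1r. Qed.

Lemma bounded_linear_comp (S T : bounded_op) : S \o T \in bounded_linear.
Proof.
have [M M0 SM] := bound_ge0 (bounded_op_prop S).
have [N N0 TN] := bound_ge0 (bounded_op_prop T).
apply/bounded_linearP; split=> [a u v|] /=.
  by rewrite !bounded_op_linear.
exists (M * N) => v; apply: le_trans (SM _) _.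
by rewrite -mulrA ler_wpM2l.
Qed.

Definition op_id := BoundedOp bounded_linear_id.
Definition op_comp (S T : bounded_op) := BoundedOp (bounded_linear_comp S T).

Fact op_compA : associative op_comp.
Proof. by move=> S T U; exact: bounded_op_ext. Qed.
Fact op_comp1l : left_id op_id op_comp.
Proof. by move=> S; exact: bounded_op_ext. Qed.
Fact op_comp1r : right_id op_id op_comp.
Proof. by move=> S; exact: bounded_op_ext. Qed.
Fact op_compDl : left_distributive op_comp +%R.
Proof. by move=> S T U; exact: bounded_op_ext. Qed.
Fact op_compDr : right_distributive op_comp +%R.
Proof.
move=> S T U; apply: bounded_op_ext => v /=; rewrite /GRing.add.
by have := bounded_op_linear S 1 (T v) (U v); rewrite !scale1r.
Qed.

(* The ring B(H), with composition as product and the identity as unit.  It is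
   only a [pzRingType], since B(H) is the zero ring when H = 0. *)
HB.instance Definition _ := GRing.Zmodule_isPzRing.Build bounded_op
  op_compA op_comp1l op_comp1r op_compDl op_compDr.

(* [GRing.unit] and [_^-1] are only available for nontrivial rings, hence the
   following counterparts for B(H). *)
Definition op_inverse (T S : bounded_op) := S * T = 1 /\ T * S = 1.

Definition op_invertible (T : bounded_op) := exists S, op_inverse T S.

Definition op_inv (T : bounded_op) : bounded_op := xget T (op_inverse T).

Lemma op_invP (T : bounded_op) : op_invertible T -> op_inverse T (op_inv T).
Proof. by move=> [S TS]; exact: (xgetPex T (ex_intro _ S TS)). Qed.

Lemma op_inv_unique (T S : bounded_op) : op_inverse T S -> op_inv T = S.
Proof.
move=> TS; have [iT _] := op_invP (ex_intro _ S TS).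
by rewrite -[RHS]mul1r -iT -mulrA TS.2 mulr1.
Qed.

Lemma inner_CauchySchwarz (u v : H) : `|inner u v| <= `|u| * `|v|.
Proof.
have [->|v0] := eqVneq v 0; first by rewrite linear0r !normr0 mulr0.
have v2 : 0 < `|v| ^+ 2 by rewrite exprn_gt0 // normr_gt0.
pose a := inner u v / `|v| ^+ 2; pose w := u - a *: v.
have wv : inner w v = 0.
  by rewrite /w linearBl /= linearZl_LR /= inner_norm divfK ?subrr ?gt_eqF.
have : 0 <= inner w w by rewrite inner_norm exprn_ge0.
rewrite {2}/w linearBr /= linearZr_LR /= wv mulr0 subr0.
rewrite /w linearBl /= linearZl_LR /= inner_norm subr_ge0 (hermC _ v u) /=.
rewrite expr0 mul1r /a mulrAC -normCK ler_pdivrMr // -exprMn.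
by rewrite ler_pXn2r ?nnegrE ?mulr_ge0.
Qed.

Definition theta_fun (y x v : H) : H := inner v x *: y.

Lemma theta_bounded_linear (y x : H) : theta_fun y x \in bounded_linear.
Proof.
apply/bounded_linearP; split=> [a u v|].
  by rewrite /theta_fun linearPl scalerDl scalerA.
exists (`|x| * `|y|) => v; rewrite /theta_fun normrZ.
by rewrite mulrAC ler_wpM2r // mulrC inner_CauchySchwarz.
Qed.

Definition theta (y x : H) : bounded_op := BoundedOp (theta_bounded_linear y x).

End BoundedOperators.

(* Main.v *)
(* With Y c = sum_j c_j y_j from column vectors to H and X v = (<v, x_i>)_i from
   H to column vectors, one has R = I - Y X and G = X Y - 1.  If G c = 0 then
   X (Y c) = c, so R (Y c) = 0; as R is injective, Y c = 0 and c = X (Y c) = 0.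
   Thus G is invertible, and with C = - G^-1,
   (I - Y X) (I + Y C X) = I - Y (1 + G C) X = I. *)

Require Import Defs.
From HB Require Import structures.
From mathcomp Require Import all_boot all_order all_algebra.
From mathcomp Require Import sesquilinear complex.
From mathcomp Require Import all_classical all_reals topology normedtype.
Import numFieldNormedType.Exports.
Import Order.TTheory GRing.Theory Num.Theory.

Set Implicit Arguments.
Unset Strict Implicit.
Unset Printing Implicit Defensive.

Local Open Scope ring_scope.
Local Open Scope complex_scope.

Section FiniteRankPerturbation.
Variables (R : realType) (H : hilbertType R).

Lemma bounded_op_sumE (I : Type) (r : seq I) (P : pred I)
    (F : I -> bounded_op H) v :
  (\sum_(i <- r | P i) F i) v = \sum_(i <- r | P i) F i v.
Proof. exact: (big_morph (fun T : bounded_op H => T v)). Qed.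

Variables (k : nat) (x y : 'I_k -> H).

(** The map Y of the factorisation; [analysis] is X. The index order in [cross_gram] makes it the
    matrix of X Y acting on columns. *)
Definition synthesis (c : 'cV[R[i]]_k) : H := \sum_(j < k) c j 0 *: y j.
Definition analysis (v : H) : 'cV[R[i]]_k := \col_i inner v (x i).
Definition cross_gram : 'M[R[i]]_k := \matrix_(i, j) inner (y j) (x i).

Fact synthesis_linear : linear synthesis.
Proof.
move=> a c d; rewrite /synthesis scaler_sumr -big_split /=.
by apply: eq_bigr => j _; rewrite !mxE scalerDl scalerA.
Qed.
HB.instance Definition _ :=
  GRing.isLinear.Build R[i] 'cV[R[i]]_k H _ synthesis synthesis_linear.

Fact analysis_linear : linear analysis.
Proof. by move=> a u v; apply/colP => i; rewrite !mxE linearPl. Qed.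
HB.instance Definition _ :=
  GRing.isLinear.Build R[i] H 'cV[R[i]]_k _ analysis analysis_linear.

Lemma analysis_synthesis c : analysis (synthesis c) = cross_gram *m c.
Proof.
rewrite /synthesis linear_sum; apply/colP => i; rewrite summxE !mxE.
by apply: eq_bigr => j _; rewrite linearZ !mxE mulrC.
Qed.

(** As [theta (y i) (x j)] sends v to <v, x_j> y_i, the double sum factors as Y A X. *)
Lemma theta_mx_sumE (A : 'M[R[i]]_k) v :
  (\sum_(i < k) \sum_(j < k) A i j *: theta (y i) (x j)) v
    = synthesis (A *m analysis v).
Proof.
rewrite bounded_op_sumE; apply: eq_bigr => i _.
rewrite bounded_op_sumE mxE scaler_suml; apply: eq_bigr => j _.
by rewrite bounded_opZE mxE -scalerA.
Qed.

Lemma theta_sumE v :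
  (\sum_(j < k) theta (y j) (x j)) v = synthesis (analysis v).
Proof. by rewrite bounded_op_sumE; apply: eq_bigr => j _; rewrite mxE. Qed.

Let T : bounded_op H := 1 - \sum_(j < k) theta (y j) (x j).

Lemma id_sub_theta_sumE v : T v = v - synthesis (analysis v).
Proof. by rewrite -theta_sumE. Qed.

Lemma cross_gram_sub1_unit : op_invertible T -> cross_gram - 1%:M \in unitmx.
Proof.
(* [det0P] yields a row vector in the left kernel, so it is applied to the transpose to get a column
   killed by the matrix itself. *)
move=> [S [ST _]]; rewrite -unitmx_tr unitmxE unitfE.
apply/negP => /det0P[u u0 /(congr1 trmx)]; rewrite trmx_mul trmxK trmx0.
rewrite mulmxBl mul1mx => /eqP; rewrite subr_eq0 -analysis_synthesis => /eqP XYu.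
have T0 : T (synthesis u^T) = 0 by rewrite id_sub_theta_sumE XYu subrr.
(* Injectivity of [T] through its left inverse: Y c = S (T (Y c)) = S 0 = 0, with c the transpose of
   [u]. *)
have Y0 : synthesis u^T = 0.
  have S0 : S 0 = 0.
    by have := bounded_op_linear S (-1) 0 0; rewrite scaler0 addr0 scaleN1r addNr.
  by rewrite -S0 -T0 -[LHS]/((1 : bounded_op H) _) -ST.
by case/eqP: u0; rewrite -[u]trmxK -XYu Y0 linear0 trmx0.
Qed.

Lemma id_sub_theta_sum_mul (C : 'M[R[i]]_k) :
  (cross_gram - 1%:M) *m C = - 1%:M ->
  T * (1 + \sum_(i < k) \sum_(j < k) C i j *: theta (y i) (x j)) = 1.
Proof.
rewrite mulmxBl mul1mx => GC; apply: bounded_op_ext => v.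
set S := \sum_(i < k) _.
rewrite -[LHS]/(T (v + S v)) theta_mx_sumE id_sub_theta_sumE.
rewrite [analysis (_ + _)]linearD /= analysis_synthesis mulmxA -addrA -linearB /=.
(* With X Y C = C - 1, the argument of Y is C X v - (X v + (C - 1) X v) = 0, leaving v. *)
have -> : cross_gram *m C = C - 1%:M by rewrite -GC addrCA subrr addr0.
by rewrite mulmxBl mul1mx addrCA subrr addr0 subrr linear0 addr0.
Qed.

End FiniteRankPerturbation.

Theorem theorem3p5 (R : realType) (H : hilbertType R) (k : nat)
    (x y : 'I_k -> H) :
  let T : bounded_op H := 1 - \sum_(j < k) theta (y j) (x j) in
  let G : 'M[R[i]]_k := \matrix_(i < k, j < k) (inner (y j) (x i) - (i == j)%:R) in
  let C : 'M[R[i]]_k := - invmx G in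
  op_invertible T ->
  G \in unitmx /\
  op_inv T = 1 + \sum_(i < k) \sum_(j < k) C i j *: theta (y i) (x j).
Proof.
move=> T G C Tinv.
have GE : G = cross_gram x y - 1%:M by apply/matrixP => i j; rewrite !mxE.
have Gu : G \in unitmx by rewrite GE cross_gram_sub1_unit.
split=> //; have [iT _] := op_invP Tinv.
have GC : (cross_gram x y - 1%:M) *m C = - 1%:M by rewrite -GE mulmxN mulmxV.
(* A right inverse of [T] suffices: as [T] is invertible, multiplying on the left by [op_inv T]
   identifies the two. *)
have := congr1 ( *%R (op_inv T)) (id_sub_theta_sum_mul GC).
by rewrite mulrA iT mul1r mulr1 => ->.
Qed.
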